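(* Let $p \in \mathbb{N}$ with $p \geqslant 3$. There exists a constant $C = C(p) > 0$ such that, for all sufficiently large $t \in \mathbb{N}$, we have $c(t,p) \geqslant C\, 2^{t} t^{3/2}$.
   Context: Graphs are finite and simple. $K_p$ denotes the complete graph on $p$ vertices, $e(G)$ the number of edges of $G$, and $\delta(G)$ the minimum degree of $G$. A graph $G$ is $H$-saturated if it contains no copy of $H$ as a (not necessarily induced) subgraph, but the addition of any new edge to $G$ (between two distinct non-adjacent vertices of $G$) creates a copy of $H$. Define $$\mathrm{sat}_{t}(n,p) = \min \{ e(G) : |V(G)| = n,\ G \text{ is } K_{p}\text{-saturated},\ \delta(G) \geqslant t \}.$$ For $t, p \in \mathbb{N}$ with $t \geqslant p-2 \geqslant 1$, $c(t,p)$ denotes the (unique) constant such that $\mathrm{sat}_{t}(n,p) = tn - c(t,p)$ for all sufficiently large $n \in \mathbb{N}$; it is a known fact that such a constant exists, i.e. that $tn - \mathrm{sat}_t(n,p)$ is eventually constant in $n$. *)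

(* Defs.v *)
From mathcomp Require Import all_boot all_order all_algebra.

Set Implicit Arguments.
Unset Strict Implicit.
Unset Printing Implicit Defensive.

Record sgraph (T : finType) := SGraph {
  adj :> rel T;
  adj_sym : symmetric adj;
  adj_irr : irreflexive adj }.

Section Graphs.
Variable T : finType.
Implicit Types G : sgraph T.

Definition edges G : {set {set T}} :=
  [set A | [exists x, exists y, G x y && (A == [set x; y])]].

Definition num_edges G : nat := #|edges G|.

Definition degree G (x : T) : nat := #|[set y | G x y]|.

(* The unit #|T| exceeds every degree, so it only matters when T is empty,
   where the value is 0. *)
Definition min_degree G : nat := \big[minn/#|T|]_(x : T) degree G x.

(* The guard x != y keeps the graph loopless even for u = v. *)
Definition add_edge_rel G (u v : T) : rel T :=
  fun x y => G x y || ((x != y) && ([set x; y] == [set u; v])).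

Lemma add_edge_sym G u v : symmetric (add_edge_rel G u v).
Proof. by move=> x y; rewrite /add_edge_rel adj_sym eq_sym setUC. Qed.

Lemma add_edge_irr G u v : irreflexive (add_edge_rel G u v).
Proof. by move=> x; rewrite /add_edge_rel adj_irr eqxx. Qed.

Definition add_edge G (u v : T) : sgraph T :=
  SGraph (add_edge_sym G u v) (add_edge_irr G u v).

End Graphs.

Definition complete_rel (p : nat) : rel 'I_p := fun x y => x != y.

Lemma complete_sym p : symmetric (@complete_rel p).
Proof. by move=> x y; rewrite /complete_rel eq_sym. Qed.

Lemma complete_irr p : irreflexive (@complete_rel p).
Proof. by move=> x; rewrite /complete_rel eqxx. Qed.

Definition complete (p : nat) : sgraph 'I_p :=
  SGraph (@complete_sym p) (@complete_irr p).

Definition contains_copy (U T : finType) (H : sgraph U) (G : sgraph T) : Prop :=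
  exists2 f : U -> T, injective f & forall x y, H x y -> G (f x) (f y).

Definition saturated (U T : finType) (H : sgraph U) (G : sgraph T) : Prop :=
  ~ contains_copy H G /\
  forall u v : T, u != v -> ~~ G u v -> contains_copy H (add_edge G u v).

Definition sat_admissible (t n p : nat) (G : sgraph 'I_n) : Prop :=
  saturated (complete p) G /\ t <= min_degree G.

(* "sat_t(n, p) = m": the minimum is attained, so this fails for every m when
   there is no admissible graph. *)
Definition is_sat (t n p m : nat) : Prop :=
  (exists2 G : sgraph 'I_n, sat_admissible t p G & num_edges G = m) /\
  (forall G : sgraph 'I_n, sat_admissible t p G -> m <= num_edges G).

(* "c(t, p) = c": sat_t(n, p) = t n - c for all sufficiently large n. *)
Definition is_sat_const (t p : nat) (c : int) : Prop :=
  exists N : nat, forall n : nat, N <= n ->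
    exists2 m : nat, is_sat t n p m & (m%:Z = (t * n)%:Z - c)%R.

Lemma is_sat_unique t n p m1 m2 :
  is_sat t n p m1 -> is_sat t n p m2 -> m1 = m2.
Proof.
move=> [[G1 a1 e1] l1] [[G2 a2 e2] l2]; apply/eqP.
by rewrite eqn_leq -{1}e2 -{2}e1 l1 // l2.
Qed.

Lemma is_sat_const_unique t p c1 c2 :
  is_sat_const t p c1 -> is_sat_const t p c2 -> c1 = c2.
Proof.
move=> [N1 h1] [N2 h2].
have [m1 s1 e1] := h1 _ (leq_maxl N1 N2).
have [m2 s2 e2] := h2 _ (leq_maxr N1 N2).
move: e1; rewrite (is_sat_unique s1 s2) e2.
by move/GRing.addrI/GRing.oppr_inj.
Qed.

(* Main.v *)
Require Import Defs.
From mathcomp Require Import all_boot all_order all_algebra.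
From mathcomp Require Import reals exp.
From mathcomp Require Import zify ring lra.

Import Order.TTheory GRing.Theory Num.Theory.

(** Since c(t, p) is the eventual value of t n - sat_t(n, p), bounding it from below only
    takes, for arbitrarily large n, one admissible graph with few edges
    ([saving_const]).

    For p = 3, a graph without triangles in which any two distinct
    non-adjacent vertices have a common neighbour is saturated.  Start from the
    complete bipartite graph between a set A of t vertices and b others, with b
    as large as desired.  Each further vertex carries a label, namely its
    neighbourhood in A, and two of these vertices are adjacent exactly when
    their labels are complementary.  No triangle appears.  If the labels form a
    family F closed under complements, then only two vertices with disjoint but
    not complementary labels can be non-adjacent without a common neighbour, so
    it remains to have none of these: disjoint members of F should be
    complementary ([label_saturated]).  Taking |S| vertices with label S makes all
    their degrees equal to |S| + |~: S| = t, whereas an edge inside the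
    labelled part is shared by two of them: compared with t edges per vertex,
    each S in F saves |S| |~: S| / 2 edges.

    The family F consists of sets of about half the size of A ([middle]), so it
    has order 2^t / sqrt t members, each saving about t^2 / 8 edges; hence the
    total 2^t t^(3/2).

    For larger p, add p - 3 dominating vertices.  Each of them raises p and the
    minimum degree by one and does not decrease the saving ([saving_cone]), so
    only the constant C changes, by a factor of order 2^(3 - p). *)

(** * Degrees, edges and complete subgraphs *)

Lemma sum_unit (F : unit -> nat) : \sum_x F x = F tt.
Proof. by rewrite (bigD1 tt) //= big_pred0 ?addn0 // => -[]. Qed.

Lemma set_id (T : finType) (A : {set T}) : [set x | x \in A] = A.
Proof. by apply/setP => x; rewrite inE. Qed.

Lemma card_set_sum (T : finType) (P : pred T) :
  #|[set x | P x]| = \sum_x (P x : nat).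
Proof. by rewrite cardsE -sum1_card big_mkcond. Qed.

Lemma degree_sum (T : finType) (G : sgraph T) x :
  degree G x = \sum_y (G x y : nat).
Proof. exact: card_set_sum. Qed.

Lemma set2_eq (T : finType) (x y u v : T) :
  [set x; y] = [set u; v] -> (x == u) && (y == v) || (x == v) && (y == u).
Proof.
move/setP=> E; move: (E x) (E y) (E u) (E v).
rewrite !inE !eqxx ?orbT /= ![u == _]eq_sym ![v == _]eq_sym.
by do 4!case: eqP => //=.
Qed.

Lemma edgesP (T : finType) (G : sgraph T) (E : {set T}) :
  reflect (exists x y, G x y /\ E = [set x; y]) (E \in edges G).
Proof.
rewrite inE; apply: (iffP existsP) => [[x /existsP[y /andP[Gxy /eqP->]]]|].
  by exists x, y.
by case=> x [y [Gxy ->]]; exists x; apply/existsP; exists y; rewrite Gxy eqxx.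
Qed.

(** Double counting of the ordered adjacent pairs, grouped by the edge that
    they span. *)
Lemma handshake (T : finType) (G : sgraph T) :
  \sum_x degree G x = 2 * num_edges G.
Proof.
pose ends (p : T * T) := [set p.1; p.2].
under eq_bigr => x _ do rewrite /degree cardsE -sum1_card.
rewrite pair_big_dep /=.
rewrite (partition_big ends (mem (edges G))) => [|[x y] /= xy]; last first.
  have Gxy : G x y := xy.
  by apply/edgesP; exists x, y.
rewrite (eq_bigr (fun=> 2)) ?sum_nat_const 1?mulnC // => E.
case/edgesP=> u [v [Guv ->]].
have uv : u != v by apply: contraTneq Guv => ->; rewrite adj_irr.
have <- : #|[set (u, v); (v, u)]| = 2 by rewrite cards2 xpair_eqE negb_and uv.
rewrite -sum1_card; apply: eq_bigl => -[x y]; rewrite !inE !xpair_eqE /=.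
apply/andP/idP => [[_ /eqP/set2_eq]//|].
case/orP=> /andP[/eqP-> /eqP->]; first by rewrite /ends eqxx.
by rewrite /ends [[set _; _]]setUC eqxx; split=> //; rewrite -topredE /= adj_sym.
Qed.

Lemma min_degree_ge (T : finType) (G : sgraph T) t :
  t <= #|T| -> (forall x, t <= degree G x) -> t <= min_degree G.
Proof.
move=> tT tG; rewrite /min_degree.
by elim/big_ind: _ => // a b ta tb; rewrite leq_min ta.
Qed.

(** Injectivity comes for free: images of distinct vertices are adjacent, hence
    distinct. *)
Lemma contains_complete (T : finType) (p : nat) (G : sgraph T) :
  contains_copy (complete p) G <->
  exists f : 'I_p -> T, forall i j, i != j -> G (f i) (f j).
Proof.
split=> [[f _ fG]|[f fG]]; first by exists f.
exists f => // i j fij; apply/eqP; apply: contraT => /fG.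
by rewrite fij adj_irr.
Qed.

Lemma contains_triangle (T : finType) (G : sgraph T) :
  contains_copy (complete 3) G <-> exists x y z, [/\ G x y, G x z & G y z].
Proof.
split=> [/contains_complete[f fG]|[x [y [z [xy xz yz]]]]].
  by exists (f (inord 0)), (f (inord 1)), (f (inord 2)); split; apply: fG;
    rewrite -val_eqE /= !inordK.
apply/contains_complete; exists (fun i : 'I_3 => nth x [:: x; y; z] i).
move=> [[|[|[|//]]] hi] [[|[|[|//]]] hj] //= _; by rewrite // adj_sym.
Qed.

Lemma triangle_saturated (T : finType) (G : sgraph T) :
  (forall x y z, G x y -> G x z -> G y z -> False) ->
  (forall x y, x != y -> ~~ G x y -> exists2 z, G x z & G y z) ->
  saturated (complete 3) G.
Proof.
move=> nt diam2; split=> [/contains_triangle[x [y [z []]]]|u v uv nuv]; first exact: nt.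
have [w uw vw] := diam2 _ _ uv nuv.
apply/contains_triangle; exists u, v, w.
by rewrite /= /add_edge_rel uw vw uv eqxx orbT.
Qed.

(** * Invariance under relabelling *)

Section Relabel.
Variables (T U : finType) (h : U -> T) (h' : T -> U).
Hypotheses (hK : cancel h h') (hK' : cancel h' h).
Variable G : sgraph T.

Lemma relabel_sym : symmetric (fun x y => G (h x) (h y)).
Proof. by move=> x y; rewrite adj_sym. Qed.

Lemma relabel_irr : irreflexive (fun x y => G (h x) (h y)).
Proof. by move=> x; rewrite adj_irr. Qed.

Definition relabel := SGraph relabel_sym relabel_irr.

Lemma relabel_degree x : degree relabel x = degree G (h x).
Proof.
rewrite !degree_sum /= [RHS](reindex h) //.
by exists h' => ? _; rewrite ?hK ?hK'.
Qed.

Lemma relabel_sum_degree : \sum_x degree relabel x = \sum_x degree G x.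
Proof.
rewrite [RHS](reindex h); last by exists h' => ? _; rewrite ?hK ?hK'.
by apply: eq_bigr => x _; rewrite relabel_degree.
Qed.

Lemma relabel_saturated p :
  saturated (complete p) G -> saturated (complete p) relabel.
Proof.
have hI := can_inj hK.
move=> [free sat]; split=> [/contains_complete[f fG]|u v uv nuv].
  by apply: free; apply/contains_complete; exists (h \o f).
have /contains_complete[f fG] : contains_copy (complete p) (add_edge G (h u) (h v)).
  by apply: sat; rewrite ?(inj_eq hI).
apply/contains_complete; exists (h' \o f) => i j /fG /=.
rewrite /add_edge_rel /= !hK' (can_eq hK') => /orP[-> //|/andP[-> /eqP/set2_eq E]].
apply/orP; right; case/orP: E => /andP[/eqP-> /eqP->]; rewrite !hK /= ?eqxx //.
by rewrite setUC eqxx.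
Qed.

End Relabel.

(** * Adding a dominating vertex *)

Section Cone.
Variables (T : finType) (G : sgraph T).

Definition cone_rel : rel (unit + T) := fun a b =>
  match a, b with
  | inr x, inr y => G x y
  | inl _, inl _ => false
  | _, _ => true
  end.

Lemma cone_sym : symmetric cone_rel.
Proof. by move=> [[]|x] [[]|y] //=; rewrite adj_sym. Qed.

Lemma cone_irr : irreflexive cone_rel.
Proof. by move=> [[]|x] //=; rewrite adj_irr. Qed.

Definition cone := SGraph cone_sym cone_irr.

Lemma cone_degree_apex : degree cone (inl tt) = #|T|.
Proof. by rewrite degree_sum big_sumType sum_unit /= sum1_card. Qed.

Lemma cone_degree_base x : degree cone (inr x) = (degree G x).+1.
Proof. by rewrite !degree_sum big_sumType sum_unit /= add1n. Qed.

Lemma cone_sum_degree : \sum_x degree cone x = \sum_x degree G x + 2 * #|T|.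
Proof.
rewrite big_sumType sum_unit cone_degree_apex /=.
under eq_bigr => x _ do rewrite cone_degree_base -addn1.
by rewrite big_split /= sum1_card addnCA mul2n -addnn.
Qed.
End Cone.

Lemma cone_complete (T : finType) (G : sgraph T) p :
  contains_copy (complete p) G -> contains_copy (complete p.+1) (cone T G).
Proof.
move=> /contains_complete[f fG]; apply/contains_complete.
exists (fun i => if unlift ord0 i is Some j then inr (f j) else inl tt).
move=> i j; case: unliftP => [i'|] ->; case: unliftP => [j'|] -> //=.
by rewrite (inj_eq (@lift_inj _ _)); apply: fG.
Qed.

(** At most one vertex of the copy is the apex; dropping it, or an arbitrary
    vertex when the apex is unused, leaves a complete graph in the base. *)
Lemma complete_cone (T : finType) (G : sgraph T) p :
  contains_copy (complete p.+1) (cone T G) -> contains_copy (complete p) G.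
Proof.
move=> /contains_complete[f fG].
pose i0 := odflt ord0 [pick i | f i == inl tt].
have fb j : exists x, f (lift i0 j) = inr x.
  case E: (f _) => [[]|x]; last by exists x.
  have Ei0 : f i0 = inl tt.
    rewrite /i0; case: pickP => [i /eqP//|/(_ (lift i0 j))]; by rewrite E.
  by have := fG _ _ (neq_lift i0 j); rewrite E Ei0.
have [g gE] := fin_all_exists fb.
apply/contains_complete; exists g => i j ij.
have := fG (lift i0 i) (lift i0 j); rewrite (inj_eq lift_inj) => /(_ ij).
by rewrite !gE.
Qed.

Lemma contains_copy_mono (U T : finType) (H : sgraph U) (G G' : sgraph T) :
  subrel G G' -> contains_copy H G -> contains_copy H G'.
Proof. by move=> GG' [f fI fG]; exists f => // x y /fG /GG'. Qed.

(** The apex is adjacent to everything, so a missing edge of the cone joins two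
    base vertices, and the cone over the graph with that edge added is the cone
    with that edge added. *)
Lemma cone_saturated (T : finType) (G : sgraph T) p :
  saturated (complete p) G -> saturated (complete p.+1) (cone T G).
Proof.
move=> [free sat]; split=> [/complete_cone//|[[]|u] [[]|v] //= uv nuv].
apply: contains_copy_mono (cone_complete _ _ _ (sat u v uv nuv)).
move=> [[]|x] [[]|y] //= /orP[xy|/andP[xy /eqP/set2_eq E]].
  by rewrite /add_edge_rel /= xy.
apply/orP; right; rewrite xy /=.
by case/orP: E => /andP[/eqP-> /eqP->]; rewrite // setUC.
Qed.

(** * From families of graphs to the constant *)

(** Degree sums stand for twice the number of edges, so a member of the family
    has at most t n - d / 2 edges.  Arbitrary finite vertex types spare the
    constructions a numbering of their vertices. *)
Definition saving (p t d : nat) := forall N, exists (T : finType) (G : sgraph T),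
  [/\ N <= #|T|, saturated (complete p) G, forall x, t <= degree G x
    & \sum_x degree G x + d <= 2 * t * #|T|].

(** Coning adds n edges, while t n grows to (t + 1) (n + 1) = t n + n + t + 1:
    nothing is lost. *)
Lemma saving_cone p t d : saving p t d -> saving p.+1 t.+1 d.
Proof.
move=> sv N; have [T [G [NT sG dG eG]]] := sv (maxn N t.+1).
exists (unit + T)%type, (cone T G); split.
- by rewrite card_sum card_unit; lia.
- exact: cone_saturated.
- by case=> [[]|x]; rewrite ?cone_degree_apex ?cone_degree_base ?ltnS //; lia.
- by rewrite cone_sum_degree card_sum card_unit; lia.
Qed.

Lemma saving_cones q p t d : saving p t d -> saving (q + p) (q + t) d.
Proof. by move=> sv; elim: q => // q /saving_cone. Qed.

Lemma saving_const p t d c :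
  saving p t d -> is_sat_const t p c -> (d%:Z <= c * 2)%R.
Proof.
move=> sv [N hN]; have [T [G [NT sG dG eG]]] := sv (maxn N t).
have [m [_ minm] mE] := hN #|T| (leq_trans (leq_maxl _ _) NT).
pose H := relabel _ _ enum_val G : sgraph 'I_#|T|.
have hK : cancel (@enum_val T T) enum_rank by exact: enum_valK.
have /minm le_m : sat_admissible t p H.
  split; first exact: relabel_saturated (@enum_rankK T) _ _ _.
  apply: min_degree_ge => [|x]; first by rewrite card_ord; lia.
  by rewrite (relabel_degree _ _ _ _ hK (@enum_rankK T)).
have := handshake _ H.
rewrite (relabel_sum_degree _ _ _ _ hK (@enum_rankK T)) => E.
by rewrite E in eG; lia.
Qed.

(** * Graphs on a labelled vertex set *)

(** The ground set A is independent, and a vertex of Y is joined to the elements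
    of its label.  The element a0 makes A nonempty, so that no set is its own
    complement. *)
Section Labelled.
Variables (A Y : finType) (a0 : A) (lab : Y -> {set A}).

Definition label_rel : rel (A + Y) := fun u v =>
  match u, v with
  | inl a, inr y | inr y, inl a => a \in lab y
  | inr y, inr z => lab z == ~: lab y
  | inl _, inl _ => false
  end.

Lemma label_sym : symmetric label_rel.
Proof. by move=> [a|y] [b|z] //=; rewrite -(inj_eq (@setC_inj _)) setCK eq_sym. Qed.

Lemma label_irr : irreflexive label_rel.
Proof.
move=> [a|y] //=; apply/eqP => /setP/(_ a0).
by rewrite inE; case: (_ \in _).
Qed.

Definition label_graph := SGraph label_sym label_irr.

Lemma label_degree_ground a : degree label_graph (inl a) = #|[set y | a \in lab y]|.
Proof.
by rewrite degree_sum big_sumType /= big1 // add0n card_set_sum.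
Qed.

Lemma label_degree y :
  degree label_graph (inr y) = #|lab y| + #|[set z | lab z == ~: lab y]|.
Proof.
by rewrite degree_sum big_sumType /= -card_set_sum set_id card_set_sum.
Qed.

Lemma label_sum_degree :
  \sum_u degree label_graph u
  = \sum_y (2 * #|lab y| + #|[set z | lab z == ~: lab y]|).
Proof.
rewrite big_sumType /=.
under eq_bigr => a _ do rewrite label_degree_ground card_set_sum.
rewrite exchange_big /= -big_split; apply: eq_bigr => y _ /=.
rewrite label_degree addnA mul2n -addnn; congr (_ + _ + _).
by rewrite -card_set_sum set_id.
Qed.

Hypothesis full : exists y, lab y = setT.
Hypothesis compl : forall y, lab y != setT -> exists z, lab z = ~: lab y.
Hypothesis disj : forall y z, lab y :&: lab z = set0 -> lab z = ~: lab y.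

(** Two ground elements have a common neighbour labelled by the whole of A.  An
    element a outside the label of y is adjacent to the vertices with the
    complementary label, which are neighbours of y.  Two vertices of Y with
    intersecting labels have a common neighbour in A, and disjoint labels are
    complementary. *)
Lemma label_saturated : saturated (complete 3) label_graph.
Proof.
have missed a y : a \notin lab y -> exists2 v, label_rel (inl a) v & label_rel (inr y) v.
  move=> ay; have [|z zE] := compl y.
    by apply: contraNneq ay => ->; rewrite inE.
  by exists (inr z) => /=; rewrite zE ?inE ?eqxx.
have clash a y z : a \in lab y -> a \in lab z -> lab z == ~: lab y -> False.
  by move=> ay az /eqP zE; move: az; rewrite zE inE ay.
apply: triangle_saturated => [|[a|y] [b|z] //= _].
- move=> [a|x] [b|y] [c|z] //=.
  + by move=> ay az; apply: clash ay az.
  + by move=> bx xz bz; apply: clash bx bz xz.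
  + by move=> xy cx cy; apply: clash cx cy xy.
  + move=> /eqP -> /eqP -> /eqP /setP/(_ a0).
    by rewrite !inE; case: (a0 \in _).
- by move=> _; have [y yE] := full; exists (inr y); rewrite /= yE inE.
- exact: missed.
- by move=> /missed[v]; exists v.
- move=> nyz; have [E|/set0Pn[a]] := eqVneq (lab y :&: lab z) set0.
    by rewrite (disj _ _ E) eqxx in nyz.
  by rewrite inE => /andP[ay az]; exists (inl a).
Qed.

End Labelled.

(** * Labels from two middle layers *)

Section Middle.
Variables (A : finType) (a0 : A) (k l : nat).
Hypotheses (k_gt0 : 0 < k) (le_kl : k <= l) (cardA : #|A| = k + l).

(** Complements stay in the family, because #|A| = k + l.  The role of a0 is to
    make disjoint members complementary even when k < l: two members of size k
    meet in a0; two of size l avoid a0, hence meet, as only k + l - 1 < 2 l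
    elements remain; and disjoint members of sizes k and l fill A. *)
Definition middle : {set {set A}} :=
  [set S : {set A} | #|S| == if a0 \in S then k else l].

Lemma middle_compl (S : {set A}) :
  S \in middle -> ~: S \in middle.
Proof.
rewrite !inE => /eqP ES; have := cardsC S; rewrite cardA ES.
by case: (a0 \in S) => /=; lia.
Qed.

Lemma middle_card (S : {set A}) :
  S \in middle -> #|S| = k /\ #|~: S| = l \/ #|S| = l /\ #|~: S| = k.
Proof.
rewrite !inE => /eqP ES; have := cardsC S; rewrite cardA ES.
by case: (a0 \in S) => /=; lia.
Qed.

Lemma middle_disjoint (S S' : {set A}) :
  S \in middle -> S' \in middle -> S :&: S' = set0 -> S' = ~: S.
Proof.
move=> SF SF' dS.
have sS : S' \subset ~: S by rewrite -disjoints_subset disjoint_sym -setI_eq0 dS.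
apply/eqP; rewrite eqEcard sS /=.
have [a0S|a0S] := boolP (a0 \in S).
  have a0S' : a0 \notin S'.
    by have /setP/(_ a0) := dS; rewrite !inE a0S => /= ->.
  have := cardsC S; move: SF SF'; rewrite !inE a0S (negbTE a0S') cardA.
  by move=> /eqP-> /eqP->; lia.
have := cardsC S; move: SF; rewrite !inE (negbTE a0S) cardA => /eqP->.
move: SF'; rewrite inE => /eqP E; rewrite E; case: ifP E => [|/negbT] a0S' E; first by lia.
(* Neither set contains a0, so a0 lies in ~: S but not in S', which would thus
   have fewer than #|~: S| = k elements; but it has l. *)
have : S' \proper ~: S by rewrite properE sS; apply/subsetPn; exists a0; rewrite ?inE.
by move/proper_card; lia.
Qed.

(** Only the members that avoid a0 are counted; complementation exchanges them
    with the others, so they are half of the family. *)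
Lemma card_middle : 'C(k + l - 1, l) <= #|middle|.
Proof.
have -> : k + l - 1 = #|[set~ a0]| by rewrite cardsC1 cardA; lia.
rewrite -cards_draws; apply/subset_leq_card/subsetP => S; rewrite !inE.
case/andP=> /subsetP sS /eqP->; case: ifP => // /sS.
by rewrite !inE eqxx.
Qed.

Variable b : nat.

(** The pairs (S, i) with i in S serve as the #|S| vertices with label S. *)
Definition slots : {set {set A} * A} := [set x | (x.1 \in middle) && (x.2 \in x.1)].

Definition slot_label (y : {x in slots} + 'I_b) : {set A} :=
  if y is inl x then (val x).1 else setT.

Lemma slot_middle (x : {x in slots}) : (val x).1 \in middle.
Proof. by have := valP x; rewrite inE => /andP[]. Qed.

Lemma middle_notT (S : {set A}) :
  S \in middle -> S != setT.
Proof.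
move=> /middle_card SF; apply/eqP => E; rewrite E setCT cards0 in SF.
by lia.
Qed.

Lemma slot_count (S : {set A}) :
  S \in middle -> #|[set y | slot_label y == S]| = #|S|.
Proof.
move=> SF; rewrite card_set_sum big_sumType /=.
rewrite [X in _ + X]big1 => [|i _]; last first.
  by rewrite eq_sym (negbTE (middle_notT _ SF)).
rewrite addn0 -(big_sub slots (fun x => (x.1 == S : nat))) big_mkcond /=.
rewrite -[RHS]mul1n -(cards1 S) -cardsX -[setX _ _]set_id card_set_sum.
apply: eq_bigr => -[S' i] _; rewrite in_setX in_set1 inE /=.
by case: (S' =P S) => [->|_]; rewrite ?SF ?if_same //=; case: (i \in S).
Qed.

(** A vertex labelled S accounts for 2 #|S| + #|~: S| in the degree sum: its own
    degree k + l, and one in the degree of each element of S.  This is #|~: S|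
    short of 2 (k + l), and the shortfalls are added up here. *)
Lemma sum_slots : \sum_(x in slots) #|~: x.1| = #|middle| * (k * l).
Proof.
rewrite -sum_nat_const.
under [RHS]eq_bigr => S SF.
  have -> : k * l = \sum_(i in S) #|~: S|.
    by rewrite sum_nat_const; case: (middle_card _ SF) => -[-> ->] //; rewrite mulnC.
  over.
rewrite pair_big_dep /=; apply: eq_bigl => -[S i]; by rewrite !inE.
Qed.

Definition middle_graph := label_graph _ _ a0 slot_label.

Lemma middle_saturated : 0 < b -> saturated (complete 3) middle_graph.
Proof.
move=> b_gt0; have full : exists y, slot_label y = setT by exists (inr (Ordinal b_gt0)).
have lab_neq0 y : slot_label y != set0.
  case: y => [x|i] /=; last by apply/set0Pn; exists a0.
  by rewrite -cards_eq0; case: (middle_card _ (slot_middle x)) => -[-> _]; lia.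
apply: label_saturated => // [[x|i] /= nT|[x|i] [y|j] /= ].
- have : 0 < #|[set y | slot_label y == ~: (val x).1]|.
    by rewrite slot_count ?middle_compl ?slot_middle // card_gt0 -(inj_eq (@setC_inj _)) setCK setC0 middle_notT // slot_middle.
  by rewrite card_gt0 => /set0Pn[y]; rewrite inE => /eqP; exists y.
- by rewrite eqxx in nT.
- by apply: middle_disjoint; apply: slot_middle.
- by rewrite setIT => E; have := lab_neq0 (inl x); rewrite /= E eqxx.
- by rewrite setTI => E; have := lab_neq0 (inl y); rewrite /= E eqxx.
- by rewrite setTI => E; have := lab_neq0 (inr j); rewrite /= E eqxx.
Qed.

(** The number of vertices with label ~: S is #|~: S|, exactly what a vertex with
    label S lacks to reach degree k + l. *)
Lemma middle_degree_slot x :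
  degree middle_graph (inr (inl x)) = k + l.
Proof.
rewrite label_degree /= slot_count ?middle_compl ?slot_middle //.
by rewrite cardsC.
Qed.

Lemma middle_degree_full i : degree middle_graph (inr (inr i)) = k + l.
Proof.
rewrite label_degree /= cardsT cardA setCT.
rewrite (_ : [set z | _] = set0) ?cards0 ?addn0 //.
apply/setP => -[x|j]; rewrite !inE /=; apply/negbTE.
  by rewrite -cards_eq0; case: (middle_card _ (slot_middle x)) => -[-> _]; lia.
by apply/set0Pn; exists a0.
Qed.

Lemma middle_degree_ge : k + l <= b -> forall u, k + l <= degree middle_graph u.
Proof.
move=> tb [a|[x|i]]; last 2 first.
- by rewrite middle_degree_slot.
- by rewrite middle_degree_full.
rewrite label_degree_ground card_set_sum big_sumType /= (leq_trans tb) //.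
rewrite [X in _ + X](eq_bigr (fun=> 1)) => [|i _]; last by rewrite inE.
by rewrite sum1_card card_ord leq_addl.
Qed.

Lemma middle_sum_degree :
  \sum_u degree middle_graph u + #|middle| * (k * l)
  <= 2 * (k + l) * #|{: A + ({x in slots} + 'I_b)}|.
Proof.
rewrite !card_sum card_ord label_sum_degree big_sumType /=.
under [X in _ + X + _]eq_bigr => i _.
  have := middle_degree_full i; rewrite label_degree /= cardsT cardA.
  rewrite -[X in _ = X]addn0 => /addnI ->; over.
rewrite sum_nat_const card_ord addn0 -sum_slots.
under eq_bigr => x _ do
  rewrite slot_count ?middle_compl ?slot_middle //.
rewrite (big_sub slots (fun x => #|~: x.1|)) addnAC -big_split /=.
under eq_bigr => x _ do
  rewrite -addnA addnn -mul2n -mulnDr cardsC cardA.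
by rewrite sum_nat_const -mulnDl mulnC leq_mul2l leq_addl orbT.
Qed.

End Middle.

Lemma saving_triangle k l : 0 < k -> k <= l ->
  saving 3 (k + l) ('C(k + l - 1, l) * (k * l)).
Proof.
move=> k0 kl N; have t0 : 0 < k + l by lia.
pose a0 := Ordinal t0; have cA : #|'I_(k + l)| = k + l by rewrite card_ord.
pose b := maxn N (k + l).
exists ('I_(k + l) + ({x in slots _ a0 k l} + 'I_b))%type, (middle_graph _ a0 k l b).
split.
- by rewrite !card_sum !card_ord /b; lia.
- by apply: middle_saturated => //; rewrite /b; lia.
- by apply: middle_degree_ge => //; rewrite /b; lia.
- apply: leq_trans (middle_sum_degree _ a0 k l k0 kl cA b).
  by rewrite leq_add2l leq_mul2r card_middle // orbT.
Qed.

(** * The central binomial coefficient *)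

Lemma central_binomial_step k : k.+1 * 'C(2 * k.+1, k.+1) = 2 * (2 * k + 1) * 'C(2 * k, k).
Proof.
have e1 := mul_bin_diag (2 * k.+1) k.
have e2 := mul_bin_down (2 * k + 1) k.
rewrite (_ : (2 * k.+1).-1 = 2 * k + 1) in e1; last lia.
rewrite (_ : (2 * k + 1).-1 = 2 * k) in e2; last lia.
rewrite (_ : 2 * k + 1 - k = k.+1) in e2; last lia.
by rewrite -e1; nia.
Qed.

(** The inductive step is (2 k + 1)^2 >= 4 k (k + 1); squaring keeps the usual
    bound 4^k / (2 sqrt k) inside the natural numbers. *)
Lemma central_binomial_ge k : 0 < k -> 16 ^ k <= 4 * k * 'C(2 * k, k) ^ 2.
Proof.
case: k => // k _; elim: k => [|k IHk]; first by [].
have := central_binomial_step k.+1.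
move: IHk; set c := 'C(2 * k.+1, _); set c' := 'C(_, _) => IHk E.
have {}E : k.+2 ^ 2 * c' ^ 2 = 4 * (2 * k.+1 + 1) ^ 2 * c ^ 2.
  by rewrite -!expnMn E !expnMn.
rewrite -(leq_pmul2l (isT : 0 < k.+2)) expnS.
have -> : k.+2 * (4 * k.+2 * c' ^ 2) = 16 * (2 * k.+1 + 1) ^ 2 * c ^ 2 by nia.
apply: (@leq_trans (16 * k.+2 * (4 * k.+1 * c ^ 2))).
  by rewrite mulnCA mulnA leq_mul2l IHk orbT.
rewrite !mulnA leq_mul2r; apply/orP; right; nia.
Qed.

Lemma bin_near_center k l : 0 < k -> k <= l <= k.+1 ->
  'C(2 * k, k) <= 2 * 'C(k + l - 1, l).
Proof.
move=> k0 /andP[kl lk]; have [->|->] : l = k \/ l = k.+1 by lia.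
  have := mul_bin_diag (2 * k) k.-1.
  rewrite prednK // (_ : (2 * k).-1 = k + k - 1); last lia.
  have : 'C(k + k - 1, k.-1) = 'C(k + k - 1, k).
    by rewrite -bin_sub; [congr 'C(_, _); lia|lia].
  by move=> ->; rewrite -mulnA [k * (_)]mulnC; nia.
have := mul_bin_left (2 * k) k.
rewrite (_ : k + k.+1 - 1 = 2 * k); last lia.
rewrite (_ : 2 * k - k = k); last lia.
by nia.
Qed.

(** * The lower bound *)

(** With t = q + (k + l) <= 3 k this compares the square of 2^t t^(3/2) with the
    square of the saving.  The constant is 1728 = 27 * 64: 27 from t <= 3 k,
    4 from 4^(k + l) <= 4 * 16^k, 4 from the central binomial coefficient and 4
    from the squared loss of a factor two in [bin_near_center]. *)
Lemma middle_saving_ge q k l : q < k -> k <= l <= k.+1 ->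
  (q + (k + l)) ^ 3 * 4 ^ (q + (k + l))
  <= 1728 * 4 ^ q * ('C(k + l - 1, l) * (k * l)) ^ 2.
Proof.
move=> qk klk; have k0 : 0 < k by lia.
set c := 'C(k + l - 1, l).
have cb := central_binomial_ge k k0; have nc := bin_near_center k l k0 klk; rewrite -/c in nc.
have pow4 : 4 ^ (q + (k + l)) <= 4 ^ q * (4 * 16 ^ k).
  rewrite -[16]/(4 ^ 2) -expnM -expnS -expnD leq_pexp2l //; lia.
have pow3 : (q + (k + l)) ^ 3 <= 27 * k ^ 3.
  by rewrite -[27]/(3 ^ 3) -expnMn leq_exp2r //; lia.
have cb' : 16 ^ k <= 4 * k * (2 * c) ^ 2.
  by apply: leq_trans cb _; rewrite leq_mul2l leq_exp2r // nc orbT.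
apply: leq_trans (leq_mul pow3 pow4) _.
apply: (@leq_trans (27 * k ^ 3 * (4 ^ q * (4 * (4 * k * (2 * c) ^ 2))))).
  by rewrite !leq_mul2l cb' !orbT.
have -> : 27 * k ^ 3 * (4 ^ q * (4 * (4 * k * (2 * c) ^ 2)))
          = 1728 * 4 ^ q * (c * (k * k)) ^ 2 by ring.
by rewrite leq_mul2l leq_exp2r // !leq_mul2l; case/andP: klk => -> _; rewrite !orbT.
Qed.

Local Open Scope ring_scope.

Lemma sqr_pow2_powR (R : realType) (t : nat) :
  (2 ^+ t * t%:R `^ (3 / 2)) ^+ 2 = ((t ^ 3 * 4 ^ t)%N)%:R :> R.
Proof.
rewrite exprMn -exprM mulnC exprM -[X in _ * X]powR_mulrn ?powR_ge0 // -powRrM.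
rewrite (_ : 3 / 2 * 2%:R = 3%:R :> R); last by field.
rewrite powR_mulrn ?ler0n // natrM !natrX mulrC; congr (_ * _ ^+ t).
by rewrite expr2; ring.
Qed.

Theorem theorem2 (R : realType) (p : nat) (hp : (3 <= p)%N) :
  exists2 C : R, 0 < C &
    exists t0 : nat, forall t : nat, (t0 <= t)%N ->
      forall c : int, is_sat_const t p c ->
        C * 2 ^+ t * t%:R `^ (3 / 2) <= c%:~R.
Proof.
pose q := (p - 3)%N; have pE : p = (q + 3)%N by rewrite /q; lia.
(* Squared, the saving bound 1728 * 4^q * (2 c)^2 is at most (84 * 2^q * c)^2,
   because 1728 * 4 = 6912 <= 7056 = 84^2. *)
exists (84 * 2 ^+ q)^-1; first by rewrite invr_gt0 mulr_gt0 ?exprn_gt0.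
(* This makes k at least q + 1, hence t <= 3 k. *)
exists (3 * q + 3)%N => t t_large c.
pose k := (t - q)./2; pose l := (t - q - k)%N.
have tE : t = (q + (k + l))%N by rewrite /l /k; lia.
have qk : (q < k)%N by rewrite /k; lia.
have klk : (k <= l <= k.+1)%N by rewrite /l /k; lia.
have k0 : (0 < k)%N by lia.
have kl : (k <= l)%N by case/andP: klk.
rewrite {1}tE pE => /(saving_const _ _ _ _ (saving_cones q _ _ _ (saving_triangle k l k0 kl))).
have := middle_saving_ge q k l qk klk; rewrite -tE.
set d := ('C(_, _) * _)%N => size_d le_dc.
have c_ge0 : 0 <= c by lia.
have dc : (d%:R : R) <= 2 * c%:~R.
  by rewrite mulrC -[2]/(2%:~R) -intrM -[d%:R]/(d%:Z%:~R) ler_int.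
have c0 : 0 <= c%:~R :> R by rewrite ler0z.
rewrite -mulrA -(ler_pXn2r (isT : (0 < 2)%N)) ?nnegrE //; last first.
  by rewrite !mulr_ge0 ?powR_ge0 ?exprn_ge0 ?invr_ge0 ?mulr_ge0 ?exprn_ge0.
rewrite exprMn sqr_pow2_powR exprVn ler_pdivrMl ?exprn_gt0 ?mulr_gt0 ?exprn_gt0 //.
apply: (@le_trans _ _ (1728 * 4 ^+ q * (2 * c%:~R) ^+ 2)).
  apply: (@le_trans _ _ (1728 * 4 ^+ q * d%:R ^+ 2)).
    by rewrite -!natrX -!natrM ler_nat.
  by rewrite ler_wpM2l ?mulr_ge0 ?exprn_ge0 // lerXn2r // ?nnegrE ?mulr_ge0.
have -> : (84 * 2 ^+ q) ^+ 2 = 7056 * 4 ^+ q :> R.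
  rewrite exprMn -exprM mulnC exprM; congr (_ * _ ^+ q); by rewrite expr2; ring.
have : 0 <= 4 ^+ q * c%:~R ^+ 2 :> R by rewrite mulr_ge0 ?exprn_ge0.
by rewrite exprMn; move: (4 ^+ q) (_ ^+ 2 : R) => x y; nra.
Qed.
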